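(* Let $E$ be a Banach space and let $\mathcal{I}_1,\mathcal{I}_2,\mathcal{I}_3,\mathcal{J}_1,\mathcal{J}_2$ be operator ideals such that $\mathcal{J}_2\subseteq\mathcal{J}_1$ and $\mathcal{I}_1\subseteq \mathcal{I}_3\cap(\mathcal{I}_1\circ\mathcal{L}_{\mathcal{J}_2})$. Consider the following conditions: (a) $\mathrm{id}_E\in\overline{\mathcal{I}_2(E;E)}^{\,\tau_{C_{\mathcal{J}_1}}}$. (b) $E$ has the $(\mathcal{I}_1,\mathcal{I}_2,\|\cdot\|)$-AP. (c) $E$ has the $(\mathcal{I}_1,\mathcal{I}_2,\tau_{C_{\mathcal{J}_2}})$-AP. (d) $E$ has the $(\mathcal{I}_3,\mathcal{I}_2,\tau_{C_{\mathcal{J}_2}})$-AP. (e) $E$ has the $(\mathcal{L},\mathcal{I}_2,\tau_{C_{\mathcal{J}_2}})$-AP. Then (a) $\Rightarrow$ (e) $\Rightarrow$ (d) $\Rightarrow$ (c) $\Leftrightarrow$ (b).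
   Context: All Banach spaces are over $\mathbb{K}=\mathbb{R}$ or $\mathbb{C}$; $\mathcal{L}(E;F)$ is the space of bounded linear operators, $B_E$ the closed unit ball of $E$, $\mathrm{id}_E$ the identity operator. Operator ideals are in the sense of Pietsch: a class $\mathcal{I}$ of bounded operators such that each component $\mathcal{I}(E;F)$ is a linear subspace of $\mathcal{L}(E;F)$ containing the finite rank operators, and $w\circ v\circ u\in\mathcal{I}$ whenever $v\in\mathcal{I}$ and $u,w$ are bounded operators (composable). $\mathcal{L}$ denotes the ideal of all bounded operators. $\mathcal{I}\circ\mathcal{J}$ is the class of operators $R\circ S$ with $R\in\mathcal{I}$, $S\in\mathcal{J}$. $\overline{A}^{\,\tau}$ is closure with respect to $\tau$, and $\|\cdot\|$ as a topology is the operator norm topology. For an operator ideal $\mathcal{J}$ and a Banach space $E$, the $\mathcal{J}$-bounded subsets of $E$ form the collection $C_{\mathcal{J}}(E)=\{A\subseteq E:\ \exists\text{ a Banach space }F\text{ and }u\in\mathcal{J}(F;E)\text{ with }A\subseteq u(B_F)\}$. $\tau_{C_{\mathcal{J}}}$ is the topology on each $\mathcal{L}(E;F)$ of uniform convergence on $\mathcal{J}$-bounded subsets of $E$ (generated by the seminorms $u\mapsto\sup_{x\in A}\|u(x)\|$, $A\in C_{\mathcal{J}}(E)$). $\mathcal{L}_{\mathcal{J}}$ is the operator ideal of $\mathcal{J}$-bounded operators: $T\in\mathcal{L}_{\mathcal{J}}(E;F)$ if every $x\in E$ has a neighborhood $V_x$ with $T(V_x)\in C_{\mathcal{J}}(F)$;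 equivalently, $T(B_E)\in C_{\mathcal{J}}(F)$. For operator ideals $\mathcal{I},\mathcal{J}$ and a topology $\tau$ assigned to all spaces $\mathcal{L}(F;E)$, a Banach space $E$ has the $(\mathcal{I},\mathcal{J},\tau)$-approximation property ($(\mathcal{I},\mathcal{J},\tau)$-AP) if $\mathcal{I}(F;E)\subseteq\overline{\mathcal{J}(F;E)}^{\,\tau}$ for every Banach space $F$. *)

(* Defs.v *)
From HB Require Import structures.
From mathcomp Require Import all_boot all_order all_algebra.
From mathcomp Require Import complex.
From mathcomp Require Import all_classical all_reals all_analysis.

Set Implicit Arguments.
Unset Strict Implicit.
Unset Printing Implicit Defensive.

Import Order.TTheory GRing.Theory Num.Theory.
Import numFieldNormedType.Exports.

Local Open Scope classical_set_scope.
Local Open Scope ring_scope.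

Definition real_or_complex (K : numFieldType) : Prop :=
  exists R : realType, K = R :> numFieldType \/ K = R[i] :> numFieldType.

Section BoundedOperators.
Context {K : numFieldType}.
Implicit Types E F G : normedModType K.

Definition bounded_operator_pred E F : {pred E -> F} :=
  fun f => `[< linear f /\ exists M : K, forall x, `|f x| <= M * `|x| >].
Arguments bounded_operator_pred : clear implicits.

Lemma bounded_operator_submod E F : submod_closed (bounded_operator_pred E F).
Proof.
split=> [|a f g].
  apply/asboolP; split=> [b x y /=|]; first by rewrite /0 /= scaler0 addr0.
  by exists 0 => x; rewrite normr0 mul0r.
move=> /asboolP[lf [M fM]] /asboolP[lg [N gN]]; apply/asboolP; split.
  move=> b x y; rewrite !fctE lf lg !scalerDr !scalerA (mulrC b a).
  by rewrite addrACA.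
exists (`|a| * M + N) => x; rewrite !fctE (le_trans (ler_normD _ _))//.
by rewrite mulrDl lerD// normrZ -mulrA ler_wpM2l.
Qed.

HB.instance Definition _ E F :=
  GRing.isSubmodClosed.Build K (E -> F) (bounded_operator_pred E F)
    (bounded_operator_submod E F).

Record bop E F := Bop {
  bop_fun :> E -> F ;
  bopP : bop_fun \in bounded_operator_pred E F }.

HB.instance Definition _ E F := [isSub for @bop_fun E F].
HB.instance Definition _ E F := [Choice of bop E F by <:].
HB.instance Definition _ E F := [SubChoice_isSubLmodule of bop E F by <:].

HB.instance Definition _ E F (u : bop E F) :=
  GRing.isLinear.Build K E F *:%R (bop_fun u) (proj1 (asboolW (bopP u))).

Lemma bop_bounded E F (u : bop E F) :
  exists M : K, forall x, `|u x| <= M * `|x|.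
Proof. exact: (proj2 (asboolW (bopP u))). Qed.

Lemma id_bop_subproof E : @idfun E \in bounded_operator_pred E E.
Proof. by apply/asboolP; split=> //; exists 1 => x; rewrite mul1r. Qed.

Definition id_bop E : bop E E := Bop (id_bop_subproof E).

Lemma comp_bop_subproof E F G (v : bop F G) (u : bop E F) :
  v \o u \in bounded_operator_pred E G.
Proof.
apply/asboolP; split=> [a x y /=|]; first by rewrite !linearP.
have [M uM] := bop_bounded u; have [N vN] := bop_bounded v.
exists (`|N| * M) => x /=.
have Nux : 0 <= N * `|u x| by exact: le_trans (normr_ge0 _) (vN _).
rewrite (le_trans (vN _))// -(ger0_norm Nux) normrM normr_id -mulrA.
exact: ler_wpM2l.
Qed.

Definition comp_bop E F G (v : bop F G) (u : bop E F) : bop E G :=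
  Bop (comp_bop_subproof v u).

Definition closed_unit_ball E : set E := [set x | `|x| <= 1].

(* The norms take their values in K, so that the suprema are taken in K too;
   when K is R[i], the upper bounds of a nonempty set of real elements for the
   (partial) order of R[i] are exactly its real upper bounds. *)
Definition opnorm E F (u : bop E F) : K :=
  supremum 0 [set `|u x| | x in @closed_unit_ball E].

Definition opball E F (u : bop E F) (r : K) : set (bop E F) :=
  [set v | opnorm (v - u) < r].

(* The topology with the open balls of the operator norm as a subbase *)
Definition opnorm_topology E F : Type := bop E F.
HB.instance Definition _ E F := Choice.on (opnorm_topology E F).
HB.instance Definition _ E F := isSubBaseTopological.Build
  (opnorm_topology E F)
  [set B : set (bop E F) | exists u r, 0 < r /\ B = opball u r] id.

(* Uniform convergence on the members of [fam]; when these are bounded, it is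
   the topology generated by the seminorms u |-> sup_(x in A) `|u x|, A in fam.
   As a subspace of the space of all functions, L(E; F) carries the initial
   topology of the inclusion. *)
Definition unif_topology E F (fam : set (set E)) : Type :=
  initial_topology (fun u : bop E F => bop_fun u : {family fam, E -> F}).
HB.instance Definition _ E F (fam : set (set E)) :=
  Topological.on (@unif_topology E F fam).

Definition finite_rank E F (u : bop E F) : Prop :=
  exists n (y : 'I_n -> F), forall x, exists c : 'I_n -> K,
    u x = \sum_(i < n) c i *: y i.

End BoundedOperators.

Arguments closed_unit_ball {K} E.

Definition operator_class (K : numFieldType) :=
  forall E F : completeNormedModType K, set (bop E F).

Record is_operator_ideal (K : numFieldType) (I : operator_class K) : Prop := {
  ideal0 : forall E F, I E F 0 ;
  idealD : forall E F u v, I E F u -> I E F v -> I E F (u + v) ;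
  idealZ : forall E F (a : K) u, I E F u -> I E F (a *: u) ;
  ideal_finite_rank : forall (E F : completeNormedModType K) (u : bop E F), finite_rank u -> I E F u ;
  ideal_comp : forall (E F G H : completeNormedModType K)
      (u : bop E F) (v : bop F G) (w : bop G H),
    I F G v -> I E H (comp_bop w (comp_bop v u)) }.

Record operator_ideal (K : numFieldType) := OperatorIdeal {
  ideal_class :> operator_class K ;
  ideal_classP : is_operator_ideal ideal_class }.

Arguments ideal_class {K} _ E F _.

Definition operator_topology (K : numFieldType) :=
  forall E F : completeNormedModType K, Topological (bop E F).

Unset Implicit Arguments.

Section ApproximationProperty.
Context {K : numFieldType}.
Implicit Types E F G : completeNormedModType K.
Implicit Types I J : operator_class K.

Definition class_sub I J : Prop := forall E F, I E F `<=` J E F.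

Definition class_inter I J : operator_class K :=
  fun E F => I E F `&` J E F.

Definition class_comp I J : operator_class K := fun E F =>
  [set T | exists G (R : bop G F) (S : bop E G),
     [/\ I G F R, J E G S & T = comp_bop R S]].

Definition all_bounded : operator_class K := fun E F => setT.

(* C_J(E) *)
Definition bounded_subsets J E : set (set E) :=
  [set A | exists F (u : bop F E), J F E u /\ A `<=` u @` closed_unit_ball F].

(* L_J *)
Definition class_bounded J : operator_class K := fun E F =>
  [set T | forall x : E, exists2 V, nbhs x V & bounded_subsets J F (T @` V)].

Definition norm_topology : operator_topology K :=
  fun E F => Topological.on (opnorm_topology E F).

Definition tauC J : operator_topology K :=
  fun E F => Topological.on (unif_topology F (bounded_subsets J E)).

Definition op_closure (tau : operator_topology K) {E F} (A : set (bop E F)) :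
    set (bop E F) :=
  @closure (Topological.Pack (tau E F)) A.

Definition AP I J (tau : operator_topology K) E : Prop :=
  forall F, I F E `<=` op_closure tau (J F E).

End ApproximationProperty.

(* Main.v *)
Require Import Defs.
From mathcomp Require Import all_boot all_order all_algebra.
From mathcomp Require Import complex.
From mathcomp Require Import all_classical all_reals all_analysis.

(* The nontrivial implications transport closures along continuous maps.
   Composition on the right with u : F -> E is continuous from tau_{C_J1} to tau_{C_J2}
   because u maps J2-bounded sets to J2-bounded, hence J1-bounded, sets: this
   gives (a) => (e). If u is moreover J2-bounded, u(B_F) is itself a J2-bounded
   set, so the same map is continuous from tau_{C_J2} to the norm topology;
   factoring an operator of I1 as R o u then gives (c) => (b). Conversely the
   norm topology is finer than tau_{C_J2}, as J2-bounded sets are bounded. *)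

Set Implicit Arguments.
Unset Strict Implicit.
Unset Printing Implicit Defensive.

Import Order.TTheory GRing.Theory Num.Theory.
Import numFieldNormedType.Exports.

Local Open Scope classical_set_scope.
Local Open Scope ring_scope.

(* For K = R[i], comparable elements share their imaginary part, so that a set
   with an upper bound lies on a horizontal line. *)
Lemma supremums_neq0 (K : numFieldType) (hK : real_or_complex K) (A : set K) :
  A !=set0 -> has_ubound A -> supremums A !=set0.
Proof.
case: hK => R [] eK; subst K => A0 ubA.
  exists (sup A); split; first exact: ub_le_sup.
  by move=> y; exact: ge_sup.
have [a Aa] := A0; have [M ubM] := ubA.
have ImA x : A x -> complex.Im x = complex.Im M.
  by move=> /ubM; rewrite lecE => /andP[/eqP].
have ubReA : has_ubound (@complex.Re R @` A).
  by exists (complex.Re M) => _ [x /ubM + <-]; rewrite lecE => /andP[].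
exists (Complex (sup (@complex.Re R @` A)) (complex.Im M)).
split=> [x Ax|y ubAy].
  by rewrite lecE/= (ImA _ Ax) eqxx/=; apply: ub_le_sup => //; exists x.
move: (ubAy _ Aa); rewrite !lecE /= (ImA _ Aa) => /andP[-> _] /=.
apply: ge_sup; first by exists (complex.Re a), a.
by move=> _ [x /ubAy + <-]; rewrite lecE => /andP[].
Qed.

Lemma closure_continuous (X Y : topologicalType) (f : X -> Y) (x : X)
    (A : set X) (B : set Y) :
  {for x, continuous f} -> f @` A `<=` B -> closure A x -> closure B (f x).
Proof.
move=> fx fAB clAx V /fx /clAx[y [Ay Vfy]].
by exists (f y); split=> //; apply: fAB; exists y.
Qed.

(** * Uniform convergence on a family of sets *)

Section BoundedOperators.
Context {K : numFieldType}.
Implicit Types E F G : normedModType K.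

Lemma bop_addE E F (u v : bop E F) x : (u + v) x = u x + v x.
Proof. by []. Qed.

Lemma bop_subE E F (u v : bop E F) x : (u - v) x = u x - v x.
Proof. by []. Qed.

Lemma bop_bounded_ge0 E F (u : bop E F) :
  exists2 M : K, 0 <= M & forall x, `|u x| <= M * `|x|.
Proof.
have [M uM] := bop_bounded u; exists `|M| => // x.
by rewrite -[`|x|]normr_id -normrM ger0_norm// (le_trans _ (uM x)).
Qed.

Lemma bop_ext E F (u v : bop E F) : u =1 v -> u = v.
Proof. by move=> uv; apply: val_inj; apply/funext. Qed.

(** The topology is initial for the inclusion into [{family fam, E -> F}], so the [e]-ball entourage
    of [F] pulls back to a neighbourhood. *)
Lemma unif_nbhs E F (fam : set (set E)) (u : bop E F) (A : set E) (e : K) :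
  fam A -> 0 < e ->
  nbhs (u : unif_topology F fam)
    [set v : bop E F | forall x, A x -> `|u x - v x| < e].
Proof.
move=> famA e0.
have /fam_cvgP/(_ A famA) :
    {family fam, (@bop_fun K E F) @ nbhs (u : unif_topology F fam) --> bop_fun u}.
  exact: (@initial_continuous _ {family fam, E -> F} (@bop_fun K E F) u).
move=> /(_ [set h | forall x, A x -> `|u x - h x| < e]); apply.
apply/uniform_nbhs; exists [set xy | ball xy.1 e xy.2]; split.
  by rewrite -entourage_ballE; exists e.
by move=> h /= + x Ax => /(_ x Ax); rewrite -ball_normE.
Qed.

(** Every entourage of [F] contains the pairs at distance less than some [e], so the sets of
    [unif_nbhs] suffice to test convergence. *)
Lemma cvg_unif E F (fam : set (set E)) (Phi : set_system (bop E F))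
    (u : bop E F) : Filter Phi ->
  (forall A e, fam A -> 0 < e ->
     Phi [set v : bop E F | forall x, A x -> `|u x - v x| < e]) ->
  Phi --> (u : unif_topology F fam).
Proof.
move=> FPhi Phiu.
have cvgu : {family fam, (@bop_fun K E F) @ Phi --> bop_fun u}.
  apply/fam_cvgP => A famA W /uniform_nbhs[D [entD DW]].
  move: entD; rewrite -entourage_ballE => -[e /= e0 eD].
  apply: filterS (Phiu A e famA e0) => v uv; apply: DW => x Ax.
  by apply: eD; rewrite /= -ball_normE; exact: uv.
move=> W [_ [[B oB <-] Bu BW]].
by apply: filterS BW _; apply: cvgu; exact: open_nbhs_nbhs.
Qed.

End BoundedOperators.

(** * The operator norm and its topology *)

Section OperatorNorm.
Context {K : numFieldType} (hK : real_or_complex K).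
Implicit Types E F G : normedModType K.

(** Rules out the default value 0 of [supremum]: the set contains [|u 0|] and is bounded above since
    [u] is bounded, so over R or R[i] it has a supremum. *)
Lemma opnorm_supremums E F (u : bop E F) :
  supremums [set `|u x| | x in closed_unit_ball E] (opnorm u).
Proof.
set A := (X in supremums X).
have A0 : A !=set0 by exists `|u 0|, 0 => //; rewrite /closed_unit_ball/= normr0.
have [M M0 uM] := bop_bounded_ge0 u.
have ubA : has_ubound A.
  by exists M => _ [x /= x1 <-]; rewrite (le_trans (uM x))// ler_piMr.
have [s sA] := supremums_neq0 hK A0 ubA.
rewrite /opnorm /supremum -/A ifF; last exact/negbTE/set0P.
by case: xgetP => [y ->|/(_ s)].
Qed.

Lemma le_opnorm E F (u : bop E F) x : closed_unit_ball E x -> `|u x| <= opnorm u.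
Proof. by move=> Bx; apply: (opnorm_supremums u).1; exists x. Qed.

Lemma opnorm_le E F (u : bop E F) c :
  (forall x, closed_unit_ball E x -> `|u x| <= c) -> opnorm u <= c.
Proof. by move=> uc; apply: (opnorm_supremums u).2 => _ [x /uc + <-]. Qed.

Lemma opnorm0 E F : opnorm (0 : bop E F) = 0.
Proof.
apply/le_anti/andP; split; first by apply: opnorm_le => x _; rewrite normr0.
have B0 : closed_unit_ball E 0 by rewrite /closed_unit_ball/= normr0.
exact: le_trans (normr_ge0 _) (le_opnorm 0 B0).
Qed.

Lemma opnormD E F (u v : bop E F) : opnorm (u + v) <= opnorm u + opnorm v.
Proof.
apply: opnorm_le => x Bx; rewrite bop_addE (le_trans (ler_normD _ _))//.
by rewrite lerD// le_opnorm.
Qed.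

Lemma opnorm_nbhs E F (u : bop E F) (e : K) : 0 < e ->
  nbhs (u : opnorm_topology E F) (opball u e).
Proof.
move=> e0; exists (opball u e); split => //;
  last by rewrite /opball/= subrr opnorm0.
exists [set opball u e]; last by rewrite bigcup_set1.
by move=> _ ->; apply: (@finI_from1 _ _ _ id (opball u e)); exists u, e.
Qed.

(** A subbasic ball containing [u] may be centred elsewhere, but by the triangle inequality it
    contains a ball about [u]. *)
Lemma cvg_opnorm E F (Phi : set_system (bop E F)) (u : bop E F) : Filter Phi ->
  (forall e, 0 < e -> Phi (opball u e)) -> Phi --> (u : opnorm_topology E F).
Proof.
(* [W] contains a finite intersection [C] of subbasic balls around various centres, each containing
   [u]; it suffices that [Phi] contains each of them. *)
move=> FPhi Phiu W [_ [[B sB <-] [C BC Cu] BW]].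
apply: filterS BW _; apply: (@filterS _ _ _ C); first by move=> v Cv; exists C.
have /sB [D sD DC] := BC; rewrite -DC; apply: filter_bigI => U DU.
have /sD := DU; rewrite inE => -[w [r [r0 Ue]]].
have : U u by move: Cu; rewrite -DC; exact.
rewrite Ue /opball/= => uw.
have := Phiu (r - opnorm (u - w)); rewrite subr_gt0 => /(_ uw).
apply: filterS => v; rewrite /opball/= ltrBrDr; apply: le_lt_trans.
by rewrite (le_trans _ (opnormD _ _))// addrA subrK.
Qed.

End OperatorNorm.

(** * Sets bounded with respect to an operator ideal *)

Section BoundedSubsets.
Context {K : numFieldType}.
Implicit Types E F G : completeNormedModType K.
Implicit Types I J : operator_ideal K.

Lemma ideal_compr I E F G (v : bop F G) (u : bop E F) :
  ideal_class I F G v -> ideal_class I E G (comp_bop v u).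
Proof.
move=> Iv; have := ideal_comp (ideal_classP I) u (id_bop G) Iv.
by congr (ideal_class I E G); exact: bop_ext.
Qed.

Lemma ideal_compl I E F G (v : bop F G) (u : bop E F) :
  ideal_class I E F u -> ideal_class I E G (comp_bop v u).
Proof.
move=> Iu; have := ideal_comp (ideal_classP I) (id_bop E) v Iu.
by congr (ideal_class I E G); exact: bop_ext.
Qed.

Lemma bounded_subsets_bounded (J : operator_class K) E A :
  bounded_subsets J E A -> exists2 M : K, 0 < M & forall x, A x -> `|x| <= M.
Proof.
move=> [F [w [_ Aw]]]; have [M M0 wM] := bop_bounded_ge0 w.
(* Adding 1 makes the bound strictly positive, so that one can divide by it. *)
exists (M + 1) => [|x /Aw[y /= By <-]]; first by rewrite ltr_wpDl.
by rewrite (le_trans (wM y))// (@le_trans _ _ M) ?ler_piMr// lerDl.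
Qed.

Lemma bounded_subsets_image J E F (u : bop E F) A :
  bounded_subsets J E A -> bounded_subsets J F (u @` A).
Proof.
move=> [G [w [Jw Aw]]]; exists G, (comp_bop u w); split; first exact: ideal_compl.
by move=> _ [x /Aw[y By <-] <-]; exists y.
Qed.

(** By linearity the neighbourhood of 0 rescales to cover the unit ball, and the ideal absorbs the
    scalar. *)
Lemma class_bounded_unit_ball J E F (u : bop E F) :
  class_bounded J E F u -> bounded_subsets J F (u @` closed_unit_ball E).
Proof.
move=> /(_ 0)[V /nbhs_ballP[r /= r0 rV] [G [w [Jw uVw]]]].
(* The factor [r / 2] sends the closed unit ball into the open ball of radius [r]. *)
have r20 : r / 2 != 0 by rewrite gt_eqF// divr_gt0.
exists G, ((r / 2)^-1 *: w); split; first exact: (idealZ (ideal_classP J)).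
move=> _ [x /= Bx <-]; have /uVw[y By wy] : (u @` V) (u ((r / 2) *: x)).
  exists ((r / 2) *: x) => //; apply: rV; rewrite -ball_normE/= sub0r normrN normrZ.
  rewrite gtr0_norm ?divr_gt0//; apply: (@le_lt_trans _ _ (r / 2)).
    by rewrite ler_piMr// divr_ge0// ltW.
  by rewrite ltr_pdivrMr// ltr_pMr// ltr1n.
exists y => //; rewrite -[LHS]/((r / 2)^-1 *: w y) wy.
by rewrite linearZ scalerA mulVf ?scale1r//.
Qed.

End BoundedSubsets.

(** * Continuous maps between operator topologies *)

Section Continuity.
Context {K : numFieldType}.
Implicit Types E F G : completeNormedModType K.

Lemma precomp_continuous (J1 J2 : operator_ideal K) E F G (u : bop F E) :
  class_sub J2 J1 ->
  continuous ((fun v => comp_bop v u) :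
    unif_topology G (bounded_subsets J1 E) ->
    unif_topology G (bounded_subsets J2 F)).
Proof.
move=> J21 v; apply: (cvg_unif (fmap_filter _ (nbhs_filter _))) => A e J2A e0.
have J1uA : bounded_subsets J1 E (u @` A).
  by have [H [w [/J21 J1w Aw]]] := J2A; apply: bounded_subsets_image; exists H, w.
apply: filterS (unif_nbhs v J1uA e0) => w vw x Ax /=.
by apply: vw; exists x.
Qed.

Lemma opnorm_unif_continuous (hK : real_or_complex K)
    (J : operator_class K) E F :
  continuous (idfun : opnorm_topology E F ->
    unif_topology F (bounded_subsets J E)).
Proof.
move=> u; apply: (cvg_unif (fmap_filter _ (nbhs_filter _))) => A e.
move=> /bounded_subsets_bounded[M M0 AM] e0.
(* Radius [e / M]: dividing by [M] brings [A] into the unit ball. *)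
apply: filterS (opnorm_nbhs hK u (divr_gt0 e0 M0)) => v vu x Ax /=.
have Bx : closed_unit_ball E (M^-1 *: x).
  rewrite /closed_unit_ball/= normrZ gtr0_norm ?invr_gt0//.
  by rewrite ler_pdivrMl// mulr1 AM.
have := le_lt_trans (le_opnorm hK (v - u) Bx) vu.
rewrite linearZ normrZ gtr0_norm ?invr_gt0// mulrC ltr_pM2r ?invr_gt0//.
by rewrite distrC.
Qed.

Lemma precomp_class_bounded_continuous (hK : real_or_complex K)
    (J : operator_ideal K) E F G (u : bop F E) :
  class_bounded J F E u ->
  continuous ((fun v => comp_bop v u) :
    unif_topology G (bounded_subsets J E) -> opnorm_topology F G).
Proof.
move=> /class_bounded_unit_ball JuB v.
apply: (cvg_opnorm hK (fmap_filter _ (nbhs_filter _))) => e e0.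
(* Pointwise strict bounds only give a weak bound on the supremum; halving [e] restores
   strictness. *)
have e20 : 0 < e / 2 by rewrite divr_gt0.
apply: filterS (unif_nbhs v JuB e20) => w vw.
apply: (@le_lt_trans _ _ (e / 2)); last by rewrite ltr_pdivrMr// ltr_pMr// ltr1n.
apply: opnorm_le => // x Bx; rewrite bop_subE distrC ltW//.
by apply: vw; exists x.
Qed.

End Continuity.

Theorem proposition3p3 (K : numFieldType) (hK : real_or_complex K)
    (E : completeNormedModType K) (I1 I2 I3 J1 J2 : operator_ideal K)
    (hJ : class_sub J2 J1)
    (hI : class_sub I1 (class_inter I3 (class_comp I1 (class_bounded J2)))) :
  let a := op_closure (tauC J1) (ideal_class I2 E E) (id_bop E) in
  let b := AP I1 I2 norm_topology E in
  let c := AP I1 I2 (tauC J2) E in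
  let d := AP I3 I2 (tauC J2) E in
  let e := AP all_bounded I2 (tauC J2) E in
  (a -> e) /\ (e -> d) /\ (d -> c) /\ (c <-> b).
Proof.
move=> a b c d e; split=> [aE F u _|].
  have -> : u = comp_bop (id_bop E) u by exact: bop_ext.
  apply: (closure_continuous
    (@precomp_continuous _ _ _ _ _ E u hJ (id_bop E)) _ aE).
  by move=> _ [v Iv <-]; exact: ideal_compr.
split=> [eE F u _|]; first exact: eE.
split=> [dE F u /hI[I3u _]|]; first exact: dE.
split=> [cE F u /hI[_ [G [R [S [I1R JS ->]]]]]|bE F u /bE bu].
  (* By (c), [R] is a limit of operators in [I2]; composed with [S] these stay in [I2] and converge
     in norm. *)
  apply: (closure_continuous
    (@precomp_class_bounded_continuous _ hK J2 G F E S JS R) _ (cE _ _ I1R)).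
  by move=> _ [v Iv <-]; exact: ideal_compr.
apply: (closure_continuous (@opnorm_unif_continuous _ hK J2 F E u) _ bu).
by move=> _ [v Iv <-].
Qed.
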